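(* Let $T \in \mathcal{B}(\mathcal{H})$. Then for any Orlicz function $\phi$ and for any $\alpha \in [0,1]$, \[\phi \left( w^2(T)\right) \leq \frac{\alpha}{2}\, \phi \left(w(T^2)\right) + \left\|\frac{\alpha}{4} \phi\left(|T|^2\right) + \left( 1- \frac{3 \alpha}{4}\right) \phi \left(|T^*|^2\right)\right\|\] and \[\phi \left( w^2(T)\right) \leq \frac{\alpha}{2}\, \phi \left(w(T^2)\right) + \left\|\frac{\alpha}{4} \phi\left(|T^*|^2\right) + \left( 1- \frac{3 \alpha}{4}\right) \phi \left(|T|^2\right)\right\|.\]
   Context: $\mathcal{B}(\mathcal{H})$ is the algebra of bounded linear operators on a complex Hilbert space $\mathcal{H}$. For $T\in\mathcal{B}(\mathcal{H})$, $T^*$ is the adjoint, $|T|=(T^*T)^{1/2}$, $|T^*|=(TT^* )^{1/2}$, $\|T\|$ is the operator norm, $w(T)=\sup_{\|x\|=1}|\langle Tx,x\rangle|$ is the numerical radius, and $w^2(T)=(w(T))^2$. For a positive operator $A$, $\phi(A)$ is defined by the continuous functional calculus. An Orlicz function is a continuous, convex, increasing function $\phi:[0,\infty)\to[0,\infty)$ with $\phi(0)=0$, $\phi(t)>0$ for all $t>0$, and $\lim_{t\to\infty}\phi(t)=\infty$. *)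

(* Defs.v *)
From HB Require Import structures.
From mathcomp Require Import all_boot all_order all_algebra.
From mathcomp Require Import complex.
From mathcomp Require Import all_classical all_reals all_analysis.

Set Implicit Arguments.
Unset Strict Implicit.
Unset Printing Implicit Defensive.

Import Order.TTheory GRing.Theory Num.Theory.
Import numFieldNormedType.Exports.

Local Open Scope classical_set_scope.
Local Open Scope ring_scope.
Local Open Scope complex_scope.

(* [inner] is linear in its first argument and conjugate-linear in the second. *)
HB.mixin Record CompleteNormedModule_isHilbert (R : realType) H
    of CompleteNormedModule R[i] H := {
  inner : {dot H for @Num.conj R[i]} ;
  sqr_normr_inner : forall x : H, `|x| ^+ 2 = inner x x
}.

#[short(type="hilbertType")]
HB.structure Definition Hilbert (R : realType) :=
  {H of CompleteNormedModule_isHilbert R H & CompleteNormedModule R[i] H}.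

Section BoundedOperators.
Context {R : realType} {H : hilbertType R}.

Definition is_bounded_op : {pred H -> H} :=
  fun f => `[< linear f /\ continuous f >].

Record bounded_op := BoundedOp {
  op_fun :> H -> H ;
  op_bounded : op_fun \in is_bounded_op
}.

HB.instance Definition _ := [isSub for op_fun].
HB.instance Definition _ := [Choice of bounded_op by <:].

Lemma is_bounded_op_submod_closed : submod_closed is_bounded_op.
Proof.
split=> [|a f g /asboolP[lf cf] /asboolP[lg cg]]; apply/asboolP; split.
- by move=> k x y; rewrite /= scaler0 addr0.
- by move=> x; apply: cvg_cst.
- move=> k x y; rewrite !fctE lf lg !scalerDr !scalerA mulrC.
  by rewrite addrACA -!addrA.
- by move=> x; apply: cvgD; [apply: cvgZl_tmp; apply: cf | apply: cg].
Qed.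

HB.instance Definition _ := GRing.isSubmodClosed.Build R[i] (H -> H)
  is_bounded_op is_bounded_op_submod_closed.
HB.instance Definition _ := [SubChoice_isSubLmodule of bounded_op by <:].

Lemma op_linear (T : bounded_op) : linear T.
Proof. by have /asboolP[] := op_bounded T. Qed.

Lemma op_continuous (T : bounded_op) : continuous T.
Proof. by have /asboolP[] := op_bounded T. Qed.

Lemma id_bounded : idfun \in is_bounded_op.
Proof. by apply/asboolP; split=> [k x y|x]; [|apply: cvg_id]. Qed.

Lemma comp_bounded (S T : bounded_op) : S \o T \in is_bounded_op.
Proof.
apply/asboolP; split=> [k x y|x]; first by rewrite /= !op_linear.
by apply: continuous_comp; apply: op_continuous.
Qed.

Definition op_one : bounded_op := BoundedOp id_bounded.
Definition op_mul (S T : bounded_op) : bounded_op :=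
  BoundedOp (comp_bounded S T).

Lemma op_mulA : associative op_mul.
Proof. by move=> S T U; apply: val_inj. Qed.
Lemma op_mul1l : left_id op_one op_mul.
Proof. by move=> T; apply: val_inj. Qed.
Lemma op_mul1r : right_id op_one op_mul.
Proof. by move=> T; apply: val_inj. Qed.
Lemma op_mulDl : left_distributive op_mul +%R.
Proof. by move=> S T U; apply: val_inj; apply/funext. Qed.
Lemma op_mulDr : right_distributive op_mul +%R.
Proof.
move=> S T U; apply: val_inj; apply/funext => x /=.
by have := op_linear S 1 (T x) (U x); rewrite !scale1r.
Qed.

(* The zero space is allowed, so 1 = 0 is possible. *)
HB.instance Definition _ := GRing.Zmodule_isPzRing.Build bounded_op
  op_mulA op_mul1l op_mul1r op_mulDl op_mulDr.

(* Norms and moduli live in [R[i]]; [Re] reads them as elements of [R]. *)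
Definition opnorm (T : bounded_op) : R :=
  sup [set complex.Re `|T x| | x in [set x : H | `|x| <= 1]].

(* For H = 0 this is [sup set0 = 0]. *)
Definition numrad (T : bounded_op) : R :=
  sup [set complex.Re `|inner (T x) x| | x in [set x : H | `|x| = 1]].

Definition adjoint (T : bounded_op) : bounded_op :=
  xget 0 [set S : bounded_op | forall x y, inner (T x) y = inner x (S y)].

Definition spectrum (A : bounded_op) : set R[i] :=
  [set l | ~ exists S : bounded_op,
     S * (A - l *: (1 : bounded_op)) = 1 /\ (A - l *: (1 : bounded_op)) * S = 1].

Definition op_poly (p : {poly R}) (A : bounded_op) : bounded_op :=
  \sum_(i < size p) (p`_i)%:C *: A ^+ i.

(* B = f(A): B is the norm limit of p_n(A) for real polynomials p_n converging
   to f uniformly on the spectrum of A. Real polynomials are enough because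
   this is only meant for self-adjoint A, whose spectrum is real. *)
Definition is_cfc (f : R -> R) (A B : bounded_op) : Prop :=
  exists2 p : nat -> {poly R},
    {uniform [set t : R | spectrum A t%:C],
       (fun n (t : R) => (p n).[t]) @ \oo --> f} &
    opnorm (op_poly (p n) A - B) @[n --> \oo] --> (0 : R).

Definition cfc (f : R -> R) (A : bounded_op) : bounded_op :=
  xget 0 [set B | is_cfc f A B].

Definition absop (T : bounded_op) : bounded_op :=
  cfc Num.sqrt (adjoint T * T).

End BoundedOperators.

Arguments bounded_op {R} H.

(* phi : [0, +oo[ -> [0, +oo[ is represented by a function on R of which only
   the restriction to [0, +oo[ matters. *)
Record orlicz {R : realType} (phi : R -> R) : Prop := {
  orlicz_ge0 : forall t : R, 0 <= t -> 0 <= phi t ;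
  orlicz_continuous : {within `[0, +oo[, continuous phi} ;
  orlicz_convex : convex_function (`[0, +oo[%classic : set R) phi ;
  orlicz_increasing : {in `[0, +oo[ &, {homo phi : s t / s <= t}} ;
  orlicz0 : phi 0 = 0 ;
  orlicz_gt0 : forall t : R, 0 < t -> 0 < phi t ;
  orlicz_cvg : phi t @[t --> +oo] --> +oo
}.

(* Main.v *)
From HB Require Import structures.
Require Import Defs.
From mathcomp Require Import all_boot all_order all_algebra.
From mathcomp Require Import complex.
From mathcomp Require Import all_classical all_reals all_analysis.
From mathcomp Require Import ring lra.

(** For a unit vector [x], Buzano's inequality applied to [T x] and [T^* x] gives
    [|<T x, x>|^2 <= |<T^2 x, x>| / 2 + (|T x|^2 + |T^* x|^2) / 4]; averaging it
    with [|<T x, x>|^2 <= |T^* x|^2] (or [|T x|^2]) with weights [alpha] and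
    [1 - alpha], the convexity of [phi] and Jensen's inequality
    [phi <A x, x> <= <phi(A) x, x>] for [A = |T|^2] and [A = |T^*|^2] yield the
    theorem.

    The functional calculus rests on one positivity statement: if a real
    polynomial [p] satisfies [c <= p] on the spectrum of a self-adjoint [A], then
    [c <= p(A)].  Indeed the infimum [m] of the numerical range of [p(A)] lies in
    the spectrum of [p(A)], and factoring [p - m] over the complex numbers exhibits
    a point [t] of the spectrum of [A], real because [A] is self-adjoint, with
    [p(t) = m].  Existence of [f(A)] then follows from the Weierstrass theorem,
    [|T|^2 = T^* T] from polynomials approximating the square root, and Jensen's
    inequality from a supporting line of [phi]. *)

Set Implicit Arguments.
Unset Strict Implicit.
Unset Printing Implicit Defensive.
Import Order.TTheory GRing.Theory Num.Theory.
Import numFieldNormedType.Exports.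
Local Open Scope classical_set_scope.
Local Open Scope ring_scope.
Local Open Scope complex_scope.
(** * Real inner product and norm *)

Section InnerProduct.
Context {R : realType} {H : hilbertType R}.
Implicit Types (x y z : H) (a b : R).

Definition rnorm x : R := complex.Re `|x|.
Definition rinner x y : R := complex.Re (inner x y).

Lemma normr_rnorm x : `|x| = (rnorm x)%:C.
Proof. by rewrite /rnorm RRe_real// ger0_real. Qed.

Lemma rnorm_ge0 x : 0 <= rnorm x.
Proof. by rewrite -ler0c -normr_rnorm. Qed.

Lemma rnorm_sqr x : rnorm x ^+ 2 = rinner x x.
Proof.
rewrite /rinner -sqr_normr_inner normr_rnorm.
by rewrite -rmorphXn.
Qed.

Lemma rnorm0 : rnorm (0 : H) = 0.
Proof. by rewrite /rnorm normr0. Qed.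

Lemma rnorm_eq0 x : rnorm x = 0 -> x = 0.
Proof. by move=> x0; apply/eqP; rewrite -normr_eq0 normr_rnorm x0. Qed.

Lemma rnorm_gt0 x : x != 0 -> 0 < rnorm x.
Proof.
move=> x0; rewrite lt_neqAle rnorm_ge0 andbT eq_sym.
by apply: contra_neq x0; exact: rnorm_eq0.
Qed.

Lemma rnormD x y : rnorm (x + y) <= rnorm x + rnorm y.
Proof. by rewrite -lecR rmorphD/= -!normr_rnorm ler_normD. Qed.

Lemma rnormN x : rnorm (- x) = rnorm x.
Proof. by rewrite /rnorm normrN. Qed.

Lemma rnormB x y : rnorm (x - y) = rnorm (y - x).
Proof. by rewrite -rnormN opprB. Qed.

Lemma innerC x y : inner x y = (inner y x)^*%C.
Proof. by rewrite hermC expr0 mul1r. Qed.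

Lemma rinnerC x y : rinner x y = rinner y x.
Proof. by rewrite /rinner innerC; case: (inner y x). Qed.

Lemma rinnerDl x y z : rinner (x + y) z = rinner x z + rinner y z.
Proof. by rewrite /rinner linearDl raddfD. Qed.

Lemma rinnerDr x y z : rinner z (x + y) = rinner z x + rinner z y.
Proof. by rewrite !(rinnerC z) rinnerDl. Qed.

Lemma rinnerNl x y : rinner (- x) y = - rinner x y.
Proof. by rewrite /rinner linearNl raddfN. Qed.

Lemma rinnerNr x y : rinner x (- y) = - rinner x y.
Proof. by rewrite !(rinnerC x) rinnerNl. Qed.

Lemma rinnerZl a x y : rinner (a%:C *: x) y = a * rinner x y.
Proof.
rewrite /rinner linearZl_LR/=; case: (inner x y) => u v /=.
by rewrite mul0r subr0.
Qed.

Lemma rinnerZr a x y : rinner x (a%:C *: y) = a * rinner x y.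
Proof. by rewrite !(rinnerC x) rinnerZl. Qed.

Lemma rinner0r x : rinner x 0 = 0.
Proof. by rewrite -[0 in LHS](scale0r (0 : H)) rinnerZr mul0r. Qed.

Lemma rnormZ (c : R[i]) x : rnorm (c *: x) = complex.Re `|c| * rnorm x.
Proof. by rewrite /rnorm normrZ normr_rnorm normc_def /= mul0r subr0. Qed.

Lemma Re_normc_real a : complex.Re `|a%:C| = `|a|.
Proof. by rewrite normc_def /= expr0n addr0 sqrtr_sqr. Qed.

Lemma rnormZr a x : rnorm (a%:C *: x) = `|a| * rnorm x.
Proof. by rewrite rnormZ Re_normc_real. Qed.

Lemma rinner_ext x y : (forall z, rinner x z = rinner y z) -> x = y.
Proof.
move=> xy; apply/eqP; rewrite -subr_eq0; apply/eqP/rnorm_eq0/eqP.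
by rewrite -sqrf_eq0 rnorm_sqr rinnerDl rinnerNl xy subrr.
Qed.

(** Conjugate-linearity in the second argument turns the imaginary part into a real part at
    ['i *: y], so equalities of inner products can be checked on real parts. *)
Lemma inner_rinner x y : inner x y = rinner x y +i* rinner x ('i *: y).
Proof.
rewrite /rinner linearZr_LR/=; case: (inner x y) => u v /=.
by congr Complex; ring.
Qed.

(** The discriminant argument, isolated because it also serves for the form [<A x, y>] of a positive
    operator and for approximate minimizers of a quadratic functional. *)
Lemma CauchySchwarz_quadratic (p q r : R) : 0 <= r ->
  (forall t : R, 0 <= p + 2 * t * q + t ^+ 2 * r) -> q ^+ 2 <= p * r.
Proof.
move=> r0 h.
have [r00|r_neq0] := eqVneq r 0.
  rewrite r00 mulr0; rewrite r00 in h.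
  have [->|q0] := eqVneq q 0; first by rewrite expr0n.
  (* For [r = 0] the expression is affine in [t], and this [t] gives it the value [-1]. *)
  have := h (- (p + 1) / (2 * q)).
  have -> : p + 2 * (- (p + 1) / (2 * q)) * q +
    (- (p + 1) / (2 * q)) ^+ 2 * 0 = -1 by field.
  by rewrite ler0N1.
have rp : 0 < r by rewrite lt_neqAle eq_sym r_neq0.
(* The minimizer of the quadratic. *)
have := h (- q / r).
have -> : p + 2 * (- q / r) * q + (- q / r) ^+ 2 * r = (p * r - q ^+ 2) / r.
  by field.
by rewrite pmulr_lge0 ?invr_gt0// subr_ge0.
Qed.

Lemma rinner_le x y : `|rinner x y| <= rnorm x * rnorm y.
Proof.
rewrite -(ler_pXn2r (ltn0Sn 1)) ?nnegrE ?mulr_ge0 ?rnorm_ge0//.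
rewrite real_normK ?num_real// exprMn !rnorm_sqr.
apply: CauchySchwarz_quadratic; first by rewrite -rnorm_sqr sqr_ge0.
move=> t; have := sqr_ge0 (rnorm (x + t%:C *: y)).
rewrite rnorm_sqr !(rinnerDl, rinnerDr, rinnerZl, rinnerZr) (rinnerC y x).
by congr (_ <= _); ring.
Qed.

(** Multiplying [x] by the unimodular [u] makes the inner product equal to its modulus, which
    reduces the claim to the real inequality. *)
Lemma inner_le x y : complex.Re `|inner x y| <= rnorm x * rnorm y.
Proof.
have [->|i0] := eqVneq (inner x y) 0.
  by rewrite normr0 mulr_ge0 ?rnorm_ge0.
pose u := `|inner x y| / inner x y.
have u1 : `|u| = 1 by rewrite /u normrM normfV normr_id divff// normr_eq0.
have -> : `|inner x y| = inner (u *: x) y by rewrite linearZl_LR/= /u divfK.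
apply: le_trans (ler_norm _) _; apply: le_trans (rinner_le _ _) _.
by rewrite rnormZ u1 mul1r.
Qed.

Lemma rnorm_complete (u : nat -> H) :
  (forall e : R, 0 < e -> exists N, forall m n, (N <= m)%N -> (N <= n)%N ->
     rnorm (u m - u n) <= e) ->
  exists l, forall e : R, 0 < e -> exists N, forall n, (N <= n)%N ->
     rnorm (u n - l) <= e.
Proof.
move=> cu.
have : cvg (u @ \oo).
  (* In the order of [R[i]], [0 < e] forces [e] to be real. *)
  apply/cauchy_cvgP/cauchy_exP => e; rewrite ltcE /= => /andP[/eqP ie e0].
  have ee : e = (complex.Re e)%:C by case: e ie {e0} => a b /= ->.
  have e20 : 0 < complex.Re e / 2 by rewrite divr_gt0.
  have [N hN] := cu _ e20; exists (u N); exists N => // n /= Nn.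
  rewrite -ball_normE /ball_/= normr_rnorm ee ltcR.
  apply: le_lt_trans (hN _ _ (leqnn N) Nn) _.
  by rewrite ltr_pdivrMr// ltr_pMr// ltr1n.
move=> /cvg_ex[l ul]; exists l => e e0.
have e0c : 0 < e%:C by rewrite ltcR.
have /cvgrPdist_le/(_ _ e0c)[N _ hN] := ul.
exists N => n Nn; have := hN n Nn.
by rewrite normr_rnorm lecR rnormB.
Qed.

End InnerProduct.

(** * Bounded operators and the operator norm *)

Section Operators.
Context {R : realType} {H : hilbertType R}.
Implicit Types (x y z : H) (S T U A B : bounded_op H).

Lemma op_ext S T : (forall x, S x = T x) -> S = T.
Proof. by move=> ST; apply: val_inj; apply/funext. Qed.

Lemma opZ T (a : R[i]) x : T (a *: x) = a *: T x.
Proof.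
have T0 : T 0 = 0.
  have := op_linear T 1 0 0; rewrite !scale1r addr0 => /eqP.
  by rewrite -subr_eq subrr => /eqP <-.
by have := op_linear T a x 0; rewrite !addr0 T0 addr0.
Qed.

Lemma opD T x y : T (x + y) = T x + T y.
Proof. by have := op_linear T 1 x y; rewrite !scale1r. Qed.

Lemma op0 T : T 0 = 0.
Proof. by have := opZ T 0 0; rewrite !scale0r. Qed.

Lemma opN T x : T (- x) = - T x.
Proof. by rewrite -scaleN1r opZ scaleN1r. Qed.

Lemma addopE S T x : (S + T) x = S x + T x. Proof. by []. Qed.
Lemma oppopE S x : (- S) x = - S x. Proof. by []. Qed.
Lemma scaleopE (a : R[i]) S x : (a *: S) x = a *: S x. Proof. by []. Qed.
Lemma mulopE S T x : (S * T) x = S (T x). Proof. by []. Qed.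
Lemma oneopE x : (1 : bounded_op H) x = x. Proof. by []. Qed.
Lemma zeroopE x : (0 : bounded_op H) x = 0. Proof. by []. Qed.
Definition opE := (addopE, oppopE, scaleopE, mulopE, oneopE, zeroopE).

Lemma op_rnorm_bound T : exists2 K : R, 0 < K &
  forall x, rnorm (T x) <= K * rnorm x.
Proof.
have lT : linear T := @op_linear _ _ T.
pose F : {linear H -> H} := HB.pack (T : H -> H)
  (GRing.isLinear.Build R[i] H H *:%R T lT).
have : bounded_near F (nbhs (0 : H)).
  by apply/linear_bounded_continuous; exact: op_continuous.
move=> /linear_boundedP/pinfty_ex_gt0[K K0 hK].
have [k Kk] : exists k : R, K = k%:C.
  by exists (complex.Re K); rewrite RRe_real// gtr0_real.
exists k; first by rewrite -ltcR -Kk.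
by move=> x; have := hK x; rewrite !normr_rnorm Kk -rmorphM lecR.
Qed.

(** Adjoints, inverses and norm limits are first built as functions and become operators through
    this lemma. *)
Lemma op_of_bound (f : H -> H) (K : R) : linear f ->
  (forall x, rnorm (f x) <= K * rnorm x) ->
  exists T, forall x, T x = f x.
Proof.
move=> lf fK.
pose F : {linear H -> H} := HB.pack f
  (GRing.isLinear.Build R[i] H H *:%R f lf).
have cf : continuous F.
  apply: bounded_linear_continuous; apply/linear_boundedP.
  exists K%:C; split; first by rewrite complex_real.
  move=> r Kr x; apply: (@le_trans _ _ (K%:C * `|x|)).
    by rewrite !normr_rnorm -rmorphM lecR.
  by rewrite ler_wpM2r// ltW.
have bf : f \in @is_bounded_op R H by apply/asboolP; split.
by exists (BoundedOp bf).
Qed.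

Lemma opnorm_has_sup T :
  has_sup [set complex.Re `|T x| | x in [set x : H | `|x| <= 1]].
Proof.
have [K K0 TK] := op_rnorm_bound T; split.
  by exists (complex.Re `|T 0|), 0 => //=; rewrite normr0.
exists K => _ [x /= + <-]; rewrite normr_rnorm (lecR _ 1) => x1.
by apply: le_trans (TK x) _; rewrite ger_pMr.
Qed.

Lemma opnorm_bound T x : rnorm (T x) <= opnorm T * rnorm x.
Proof.
have [->|x0] := eqVneq x 0; first by rewrite op0 rnorm0 mulr0.
have rx := rnorm_gt0 x0.
have ri : 0 <= (rnorm x)^-1 by rewrite invr_ge0 ltW.
have h : complex.Re `|T ((rnorm x)^-1%:C *: x)| <= opnorm T.
  apply: sup_upper_bound (opnorm_has_sup T) _ _.
  exists ((rnorm x)^-1%:C *: x) => //.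
  rewrite /= normr_rnorm (lecR _ 1) rnormZr ger0_norm//.
  by rewrite mulVf ?gt_eqF//.
move: h; rewrite opZ -/(rnorm _) rnormZr ger0_norm//.
by rewrite ler_pdivrMl// mulrC.
Qed.

Lemma opnorm_le T (K : R) : 0 <= K ->
  (forall x, rnorm (T x) <= K * rnorm x) -> opnorm T <= K.
Proof.
move=> K0 TK; apply: ge_sup; first by have [] := opnorm_has_sup T.
move=> _ [x /= + <-]; rewrite normr_rnorm (lecR _ 1) => x1.
by apply: le_trans (TK x) _; rewrite ler_piMr.
Qed.

Lemma opnorm_ge0 T : 0 <= opnorm T.
Proof.
apply: (sup_upper_bound (opnorm_has_sup T)).
by exists 0 => /=; rewrite ?op0 normr0.
Qed.

End Operators.

(** * Passing to the limit with real epsilons *)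

Section RealLemmas.
Context {R : realType}.

Lemma le_epsM_eq0 (q C : R) : (forall e : R, 0 < e -> `|q| <= e * C) -> q = 0.
Proof.
move=> h; apply/eqP; rewrite -normr_le0 leNgt; apply/negP => q0.
have C0 : 0 < C by have := h 1 ltr01; rewrite mul1r; exact: lt_le_trans.
have := h (`|q| / 2 / C) (divr_gt0 (divr_gt0 q0 (ltr0Sn _ 1)) C0).
by rewrite divfK ?gt_eqF// leNgt ltr_pdivrMr// ltr_pMr// ltr1n.
Qed.

Lemma ex_natSinv_le (e : R) : 0 < e ->
  exists N, forall n, (N <= n)%N -> n.+1%:R^-1 <= e.
Proof.
move=> e0; have [N _ hN] := near_infty_natSinv_lt (PosNum e0).
by exists N => n /hN/ltW.
Qed.

End RealLemmas.

(** * The Lax-Milgram lemma and adjoints *)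

Section LaxMilgram.
Context {R : realType} {H : hilbertType R}.
Implicit Types (x y z : H) (S T U A B : bounded_op H).

(* Minimizing [J x = <S x, x> - 2 f x]: by the parallelogram identity a
   minimizing sequence is Cauchy, and its limit solves the Euler equation. *)
Lemma lax_milgram S (c L : R) (f : H -> R) : 0 < c ->
  (forall x y, rinner (S x) y = rinner x (S y)) ->
  (forall x, c * rnorm x ^+ 2 <= rinner (S x) x) ->
  {morph f : x y / x + y} -> (forall a x, f (a%:C *: x) = a * f x) ->
  (forall x, `|f x| <= L * rnorm x) ->
  exists y, forall h, rinner (S y) h = f h.
Proof.
move=> c0 Ssym Sc fD fZ fL.
pose J x := rinner (S x) x - 2 * f x.
(* Along a line the linear coefficient of [J] is twice the residual of the equation to be solved. *)
have JE x h (t : R) : J (x + t%:C *: h) =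
    J x + 2 * t * (rinner (S x) h - f h) + t ^+ 2 * rinner (S h) h.
  rewrite /J !(opD, opZ) !(rinnerDl, rinnerDr, rinnerZl, rinnerZr) fD fZ.
  by rewrite (Ssym h x) (rinnerC h (S x)); ring.
(* [J x] is at least [c r^2 - 2 L r] with [r = rnorm x]; complete the square. *)
have Jlb x : - (L ^+ 2 / c) <= J x.
  have h1 := Sc x; have := fL x; rewrite ler_norml => /andP[_ h2].
  have : 0 <= c * (rnorm x - L / c) ^+ 2 by rewrite mulr_ge0 ?sqr_ge0 ?ltW.
  have -> : c * (rnorm x - L / c) ^+ 2 =
      c * rnorm x ^+ 2 - 2 * (L * rnorm x) + L ^+ 2 / c.
    by field; rewrite gt_eqF.
  by rewrite /J; lra.
have Jinf : has_inf (range J).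
  by split; [exists (J 0), 0 | exists (- (L ^+ 2 / c)) => _ [x _ <-]].
pose m := inf (range J).
have Jm x : m <= J x by apply: (ge_inf (proj2 Jinf)); exists x.
have /choice[u uJ] : forall n : nat, exists x, J x < m + n.+1%:R^-1.
  move=> n; have n0 : 0 < n.+1%:R^-1 :> R by rewrite invr_gt0.
  by have [_ [x _ <-] Jx] := inf_adherent n0 Jinf; exists x.
have [e e0|y uy] := @rnorm_complete _ _ u.
  have ec : 0 < c * e ^+ 2 / 4 by rewrite divr_gt0// mulr_gt0// exprn_gt0.
  have [N hN] := ex_natSinv_le ec; exists N => i j /hN Ni /hN Nj.
  rewrite -(ler_pXn2r (ltn0Sn 1)) ?nnegrE ?rnorm_ge0 ?(ltW e0)//.
  (* Comparing [J] at [u i], at [u j] and at their midpoint, where it is at least [m], bounds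
     [<S d, d>] for [d = u j - u i] by twice the sum of the two deficits, each at most
     [c e^2 / 4]. *)
  rewrite -(ler_pM2l c0); apply: le_trans (Sc _) _.
  have := JE (u i) (u j - u i) 1; have := JE (u i) (u j - u i) (2^-1).
  have := Jm (u i + (2^-1)%:C *: (u j - u i)).
  rewrite scale1r addrCA subrr addr0.
  have -> : rinner (S (u i - u j)) (u i - u j) =
      rinner (S (u j - u i)) (u j - u i).
    by rewrite -(opprB (u j)) opN rinnerNl rinnerNr opprK.
  move: (uJ i) (uJ j); set p := J _; set q := J _; set r := J _.
  move: Ni Nj; move: (i.+1%:R^-1) (j.+1%:R^-1) => di dj Ni Nj.
  set s := rinner (S (u j - _)) _; set t := _ - f _.
  clearbody p q r s t m; clear -Ni Nj => h1 h2 h3 h4 h5; nra.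
exists y => h; apply/eqP; rewrite -subr_eq0; apply/eqP.
apply: (@le_epsM_eq0 _ _ (rnorm (S h) + (1 + rinner (S h) h))) => e e0.
have ah0 : 0 <= rinner (S h) h.
  by apply: le_trans (Sc h); rewrite mulr_ge0 ?sqr_ge0 ?ltW.
have [N1 hN1] := uy _ e0.
have [N2 hN2] := ex_natSinv_le (exprn_gt0 2 e0).
pose n := maxn N1 N2.
have un : rnorm (u n - y) <= e by apply: hN1; exact: leq_maxl.
have dn : n.+1%:R^-1 <= e ^+ 2 by apply: hN2; exact: leq_maxr.
have -> : rinner (S y) h - f h =
    - rinner (u n - y) (S h) + (rinner (S (u n)) h - f h).
  by rewrite rinnerDl rinnerNl -!Ssym; ring.
apply: le_trans (ler_normD _ _) _; rewrite mulrDr lerD//.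
  rewrite normrN; apply: le_trans (rinner_le _ _) _.
  by rewrite ler_wpM2r// rnorm_ge0.
rewrite -(ler_pXn2r (ltn0Sn 1)) ?nnegrE ?mulr_ge0 ?addr_ge0 ?(ltW e0)//.
rewrite real_normK ?num_real//.
apply: (@le_trans _ _ (e ^+ 2 * rinner (S h) h)).
  (* Since [J (u n)] exceeds the infimum by at most [e^2], the quadratic with constant term [e^2] is
     nonnegative in [t]. *)
  apply: CauchySchwarz_quadratic => // t.
  have := Jm (u n + t%:C *: h); rewrite JE; have := uJ n.
  clearbody m; move: (n.+1%:R^-1) dn => d dn h1 h2.
  move: (J (u n)) h1 h2 => p h1 h2;
  move: (rinner (S h) h) (_ - f h) h2 => q r; clear -h1 dn; lra.
rewrite exprMn ler_wpM2l ?sqr_ge0//; nra.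
Qed.

Definition selfadjoint A := forall x y, inner (A x) y = inner x (A y).

Lemma selfadjoint_rinner A : selfadjoint A ->
  forall x y, rinner (A x) y = rinner x (A y).
Proof. by move=> sA x y; rewrite /rinner sA. Qed.

(** The Lax-Milgram lemma with the identity operator is the Riesz representation theorem; it gives
    [S y] as the vector representing [h |-> Re <T h, y>]. *)
Lemma adjointP T x y : inner (T x) y = inner x (adjoint T y).
Proof.
suff [S TS] : exists S, forall x y, inner (T x) y = inner x (S y).
  rewrite /adjoint; case: xgetP => [U _ -> //|/(_ S)]; exact: contra_notP.
have [K K0 TK] := op_rnorm_bound T.
have /choice[g gT] : forall y, exists z, forall h, rinner z h = rinner (T h) y.
  move=> {}y; apply: (@lax_milgram 1 1 (K * rnorm y)) => //.
  - by move=> {}x; rewrite mul1r rnorm_sqr.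
  - by move=> u v; rewrite opD rinnerDl.
  - by move=> a u; rewrite opZ rinnerZl.
  - move=> u; apply: le_trans (rinner_le _ _) _.
    by rewrite mulrAC ler_wpM2r// rnorm_ge0.
have gi u v : inner (T u) v = inner u (g v).
  rewrite innerC (innerC u); congr (conjc _).
  rewrite !inner_rinner; congr Complex; first by rewrite gT rinnerC.
  by rewrite gT opZ rinnerC.
have lg : linear g.
  move=> a u v; apply: rinner_ext => z.
  rewrite rinnerC [RHS]rinnerC /rinner -gi !(linearDr, linearZr_LR)/=.
  by rewrite !gi.
have [|S SE] := @op_of_bound _ _ g K lg.
  move=> u; have [->|gu0] := eqVneq (g u) 0.
    by rewrite rnorm0 mulr_ge0 ?rnorm_ge0 ?ltW.
  rewrite -(ler_pM2r (rnorm_gt0 gu0)) -expr2 rnorm_sqr gT.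
  apply: le_trans (ler_norm _) _; apply: le_trans (rinner_le _ _) _.
  by rewrite mulrAC ler_wpM2r ?rnorm_ge0.
by exists S => u v; rewrite SE gi.
Qed.

Lemma adjointK T : adjoint (adjoint T) = T.
Proof.
apply: op_ext => y; apply: rinner_ext => z.
by rewrite rinnerC [RHS]rinnerC /rinner -adjointP innerC -adjointP -innerC.
Qed.

Definition op_invertible A := exists S, S * A = 1 /\ A * S = 1.

(** The Lax-Milgram lemma gives surjectivity; coercivity bounds [A] below by [c], hence gives
    injectivity and an inverse bounded by [c^-1]. *)
Lemma coercive_invertible A (c : R) : 0 < c -> selfadjoint A ->
  (forall x, c * rnorm x ^+ 2 <= rinner (A x) x) -> op_invertible A.
Proof.
move=> c0 sA Ac.
have /choice[g gA] : forall y, exists z, A z = y.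
  move=> y; have [] := @lax_milgram A c (rnorm y) (rinner y) => //.
  - exact: selfadjoint_rinner.
  - by move=> u v; rewrite rinnerDr.
  - by move=> a u; rewrite rinnerZr.
  - by move=> u; exact: rinner_le.
  by move=> z Az; exists z; exact: rinner_ext.
have Alb x : c * rnorm x <= rnorm (A x).
  have [->|x0] := eqVneq x 0; first by rewrite rnorm0 mulr0 rnorm_ge0.
  rewrite -(ler_pM2r (rnorm_gt0 x0)) -mulrA -expr2.
  apply: le_trans (Ac x) _; apply: le_trans (ler_norm _) _.
  exact: rinner_le.
have Ainj x y : A x = A y -> x = y.
  move=> /eqP; rewrite -subr_eq0 -opN -opD => /eqP Axy.
  apply/eqP; rewrite -subr_eq0; apply/eqP/rnorm_eq0/eqP.
  rewrite eq_le rnorm_ge0 andbT -(pmulr_rle0 _ c0).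
  by apply: le_trans (Alb _) _; rewrite Axy rnorm0.
have lg : linear g by move=> a u v; apply: Ainj; rewrite opD opZ !gA.
have [|S SE] := @op_of_bound _ _ g c^-1 lg.
  by move=> u; rewrite ler_pdivlMl// -[u in leRHS]gA Alb.
exists S; split; apply: op_ext => x; rewrite !opE SE ?gA//.
by apply: Ainj; rewrite gA.
Qed.

End LaxMilgram.

(** * Polynomial calculus and spectrum *)

Section PolynomialCalculus.
Context {R : realType} {H : hilbertType R}.
Implicit Types (x y z : H) (S T U A B : bounded_op H) (P Q : {poly R[i]}).

Lemma scaleopAl (a : R[i]) S T : (a *: S) * T = a *: (S * T).
Proof. exact: op_ext. Qed.

Lemma scaleopAr (a : R[i]) S T : S * (a *: T) = a *: (S * T).
Proof. by apply: op_ext => x; rewrite !opE opZ. Qed.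

(** Complex coefficients are allowed so that polynomials in [A] can be split into linear factors. *)
Definition cpoly P A : bounded_op H := \sum_(i < size P) P`_i *: A ^+ i.

Lemma cpoly_widen P A n : (size P <= n)%N ->
  cpoly P A = \sum_(i < n) P`_i *: A ^+ i.
Proof.
move=> Pn; rewrite /cpoly -!(big_mkord xpredT (fun i => P`_i *: A ^+ i)).
rewrite [RHS](big_cat_nat (n := size P))//= [X in _ = _ + X]big_nat_cond.
rewrite [X in _ = _ + X]big1 ?addr0// => i /andP[/andP[Pi _] _].
by rewrite nth_default// scale0r.
Qed.

Lemma cpoly0 A : cpoly 0 A = 0.
Proof. by rewrite /cpoly size_poly0 big_ord0. Qed.

Lemma cpolyC (c : R[i]) A : cpoly c%:P A = c *: (1 : bounded_op H).
Proof.
by rewrite (@cpoly_widen _ _ 1) ?size_polyC_leq1// big_ord1 coefC expr0.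
Qed.

Lemma cpolyD P Q A : cpoly (P + Q) A = cpoly P A + cpoly Q A.
Proof.
pose n := maxn (size P) (size Q).
rewrite !(@cpoly_widen _ _ n) ?leq_maxl ?leq_maxr ?size_polyD// -big_split.
by apply: eq_bigr => i _; rewrite coefD scalerDl.
Qed.

Lemma cpolyMX P A : cpoly (P * 'X) A = cpoly P A * A.
Proof.
rewrite (@cpoly_widen _ _ (size P).+1) ?(leq_trans (size_polyMleq _ _))//;
  last by rewrite size_polyX addn2.
rewrite big_ord_recl coefMX eqxx scale0r add0r /cpoly mulr_suml.
by apply: eq_bigr => i _; rewrite coefMX/= scaleopAl exprSr.
Qed.

Lemma cpolyX A : cpoly 'X A = A.
Proof. by rewrite -[in LHS](mul1r 'X) cpolyMX cpolyC scale1r mul1r. Qed.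

Lemma cpolyCM (c : R[i]) P A : cpoly (c%:P * P) A = c *: cpoly P A.
Proof.
rewrite (@cpoly_widen _ _ (size P)); last first.
  by rewrite mul_polyC size_scale_leq.
rewrite /cpoly scaler_sumr; apply: eq_bigr => i _.
by rewrite coefCM scalerA.
Qed.

Lemma cpoly_comm P A : cpoly P A * A = A * cpoly P A.
Proof.
rewrite /cpoly mulr_suml mulr_sumr; apply: eq_bigr => i _.
by rewrite scaleopAl scaleopAr -exprSr -exprS.
Qed.

Lemma cpolyM P Q A : cpoly (P * Q) A = cpoly P A * cpoly Q A.
Proof.
elim/poly_ind: P => [|P c IH]; first by rewrite mul0r cpoly0 mul0r.
rewrite mulrDl -mulrA (mulrC 'X) mulrA !cpolyD !cpolyMX IH cpolyCM cpolyC.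
by rewrite mulrDl -!mulrA cpoly_comm scaleopAl mul1r.
Qed.

Lemma cpoly_commM P Q A : cpoly P A * cpoly Q A = cpoly Q A * cpoly P A.
Proof. by rewrite -!cpolyM mulrC. Qed.

Lemma op_polyE (p : {poly R}) A :
  op_poly p A = cpoly (map_poly (real_complex R) p) A.
Proof.
rewrite /op_poly /cpoly size_map_poly; apply: eq_bigr => i _.
by rewrite coef_map.
Qed.

Lemma op_polyD (p q : {poly R}) A :
  op_poly (p + q) A = op_poly p A + op_poly q A.
Proof. by rewrite !op_polyE rmorphD cpolyD. Qed.

Lemma op_polyM (p q : {poly R}) A :
  op_poly (p * q) A = op_poly p A * op_poly q A.
Proof. by rewrite !op_polyE rmorphM cpolyM. Qed.

Lemma op_polyC (c : R) A : op_poly c%:P A = c%:C *: (1 : bounded_op H).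
Proof. by rewrite op_polyE map_polyC cpolyC. Qed.

Lemma op_polyX A : op_poly 'X A = A.
Proof. by rewrite op_polyE map_polyX cpolyX. Qed.

Lemma op_polyN (p : {poly R}) A : op_poly (- p) A = - op_poly p A.
Proof.
by rewrite -mulN1r -polyCN op_polyM op_polyC rmorphN scaleN1r mulN1r.
Qed.

Lemma op_poly_selfadjoint (p : {poly R}) A :
  selfadjoint A -> selfadjoint (op_poly p A).
Proof.
move=> sA; elim/poly_ind: p => [|p c IH] x y.
  by rewrite /op_poly size_poly0 big_ord0 linear0l linear0r.
rewrite op_polyD op_polyM op_polyX op_polyC !opE linearDl linearDr.
rewrite linearZl_LR linearZr_LR/= IH sA -[LHS]/(_ + c%:C * _); congr (_ + _).
  have /(congr1 (fun T : bounded_op H => T y)) :=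
    cpoly_comm (map_poly (real_complex R) p) A.
  by rewrite -op_polyE !opE => ->.
by congr (_ * _); rewrite -[LHS]conjc_real.
Qed.

(** * Invertibility and the spectrum of a self-adjoint operator *)

Lemma op_invertible1 : op_invertible (1 : bounded_op H).
Proof. by exists 1; rewrite mul1r. Qed.

Lemma op_invertibleM S T :
  op_invertible S -> op_invertible T -> op_invertible (S * T).
Proof.
move=> [S' [S'S SS']] [T' [T'T TT']]; exists (T' * S'); split.
  by rewrite mulrA -(mulrA T') S'S mulr1.
by rewrite mulrA -(mulrA S) TT' mulr1.
Qed.

Lemma op_invertibleZ (c : R[i]) S :
  c != 0 -> op_invertible S -> op_invertible (c *: S).
Proof.
move=> c0 [S' [S'S SS']]; exists (c^-1 *: S').
by rewrite !scaleopAl !scaleopAr !scalerA divff// mulVf// S'S SS' scale1r.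
Qed.

(** With [U] the inverse of the product, [U * T] is a left inverse of [S] and [T * U] a right
    inverse, so the two agree. *)
Lemma op_invertible_comm S T : S * T = T * S ->
  op_invertible (S * T) -> op_invertible S.
Proof.
move=> ST [U [UST STU]]; exists (T * U).
have E : T * U = U * T.
  transitivity (U * (T * S) * (T * U)); first by rewrite -ST UST mul1r.
  by rewrite -!mulrA (mulrA S) STU mulr1.
split; last by rewrite mulrA.
by rewrite E -mulrA -ST.
Qed.

Lemma spectrumN A (l : R[i]) :
  ~ spectrum A l -> op_invertible (A - l *: (1 : bounded_op H)).
Proof. by move=> /contrapT. Qed.

(** If no root of [P] lay in the spectrum, every linear factor of [P] would be invertible at [A],
    and so would their product. *)
Lemma spectrum_poly A P : P != 0 -> ~ op_invertible (cpoly P A) ->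
  exists2 l, root P l & spectrum A l.
Proof.
move=> P0 Pinv; apply/not_exists2P => h; apply: Pinv.
have [s Ps] := closed_field_poly_normal P.
have rs l : l \in s -> op_invertible (A - l *: (1 : bounded_op H)).
  move=> ls; have [|//] := h l; last exact: spectrumN.
  by case; rewrite Ps rootZ ?lead_coef_eq0// root_prod_XsubC.
rewrite Ps -mul_polyC cpolyCM; apply: op_invertibleZ.
  by rewrite lead_coef_eq0.
elim: s rs {Ps} => [|l s IH] rs.
  by rewrite big_nil -polyC1 cpolyC scale1r; exact: op_invertible1.
rewrite big_cons cpolyM; apply: op_invertibleM; last first.
  by apply: IH => k ks; apply: rs; rewrite inE ks orbT.
rewrite -polyCN cpolyD cpolyX cpolyC scaleNr; apply: rs.
by rewrite inE eqxx.
Qed.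

Lemma selfadjoint_shift A (a : R) : selfadjoint A ->
  selfadjoint (A - a%:C *: (1 : bounded_op H)).
Proof.
move=> sA; suff -> : A - a%:C *: (1 : bounded_op H) = op_poly ('X - a%:P) A.
  exact: op_poly_selfadjoint.
by rewrite op_polyD op_polyN op_polyX op_polyC.
Qed.

(** For [l = a + i b] with [b != 0], the product of [A - l] and [A - conj l] is [(A - a)^2 + b^2],
    which is coercive with constant [b^2]. *)
Lemma spectrum_real A (l : R[i]) : selfadjoint A -> spectrum A l ->
  l = (complex.Re l)%:C.
Proof.
case: l => a b sA Al; have [->//|b0] := eqVneq b 0; exfalso; apply: Al.
pose q : {poly R} := ('X - a%:P) * ('X - a%:P) + (b ^+ 2)%:P.
have qE : map_poly (real_complex R) q =
    ('X - (a +i* b)%:P) * ('X - (a -i* b)%:P).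
  rewrite /q rmorphD rmorphM rmorphB /= map_polyX !map_polyC/=.
  have -> : a +i* b = a%:C + 'i%C * b%:C by congr Complex => /=; ring.
  have -> : a -i* b = a%:C - 'i%C * b%:C by congr Complex => /=; ring.
  rewrite !polyCD polyCN !polyCM.
  have -> : (b ^+ 2)%:C%:P = - ('i%C)%:P ^+ 2 * (b%:C)%:P ^+ 2 :> {poly R[i]}.
    by rewrite -!polyC_exp -polyCN -polyCM sqr_i opprK mul1r rmorphXn.
  ring.
have E l : A - l *: (1 : bounded_op H) = cpoly ('X - l%:P) A.
  by rewrite -polyCN cpolyD cpolyX cpolyC scaleNr.
rewrite -/(op_invertible _) E.
apply: (@op_invertible_comm _ (cpoly ('X - (a -i* b)%:P) A)).
  exact: cpoly_commM.
rewrite -cpolyM -qE -op_polyE.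
apply: (@coercive_invertible _ _ _ (b ^+ 2)).
- by rewrite exprn_even_gt0.
- exact: op_poly_selfadjoint.
move=> x; rewrite op_polyD op_polyM op_polyC !opE rinnerDl rinnerZl rnorm_sqr.
rewrite lerDr (selfadjoint_rinner (op_poly_selfadjoint _ sA)).
by rewrite -rnorm_sqr sqr_ge0.
Qed.

Lemma spectrum_ge A (c : R) : selfadjoint A ->
  (forall x, c * rnorm x ^+ 2 <= rinner (A x) x) ->
  forall t : R, spectrum A t%:C -> c <= t.
Proof.
move=> sA Ac t At; rewrite leNgt; apply/negP => tc; apply: At.
apply: (@coercive_invertible _ _ _ (c - t)); first by rewrite subr_gt0.
  exact: selfadjoint_shift.
move=> x; rewrite !opE rinnerDl rinnerNl rinnerZl -rnorm_sqr mulrBl.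
by rewrite lerD2r.
Qed.

Lemma spectrum_le A (c : R) : selfadjoint A ->
  (forall x, rinner (A x) x <= c * rnorm x ^+ 2) ->
  forall t : R, spectrum A t%:C -> t <= c.
Proof.
move=> sA Ac t At; rewrite leNgt; apply/negP => tc; apply: At.
have E : A - t%:C *: (1 : bounded_op H) =
    (-1) *: (op_poly (t%:P - 'X) A).
  rewrite op_polyD op_polyN op_polyX op_polyC scaleN1r opprD opprK.
  by rewrite addrC.
rewrite -/(op_invertible _) E; apply: op_invertibleZ.
  by rewrite oppr_eq0 oner_eq0.
apply: (@coercive_invertible _ _ _ (t - c)); first by rewrite subr_gt0.
  exact: op_poly_selfadjoint.
move=> x; rewrite op_polyD op_polyN op_polyX op_polyC !opE.
by rewrite rinnerDl rinnerNl rinnerZl -rnorm_sqr mulrBl lerD2l lerN2.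
Qed.

(* The Cauchy-Schwarz inequality of the form [<A x, y>] at [y = A x]. *)
Lemma positive_sqr_le A : selfadjoint A -> (forall x, 0 <= rinner (A x) x) ->
  exists2 K : R, 0 < K & forall x, rnorm (A x) ^+ 2 <= K * rinner (A x) x.
Proof.
move=> sA A0; have [K K0 AK] := op_rnorm_bound A; exists K => // x.
have [Ax0|Ax0] := eqVneq (A x) 0.
  by rewrite {1}Ax0 rnorm0 expr0n/= mulr_ge0 ?(ltW K0).
have r0 : 0 < rnorm (A x) ^+ 2 by rewrite exprn_gt0// rnorm_gt0.
rewrite -(ler_pM2r r0).
have := @CauchySchwarz_quadratic R (rinner (A x) x) (rinner (A x) (A x))
  (rinner (A (A x)) (A x)) (A0 _).
rewrite -rnorm_sqr => h; rewrite -expr2.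
apply: le_trans (h _) _.
  move=> t; have := A0 (x + t%:C *: A x).
  rewrite !(opD, opZ) !(rinnerDl, rinnerDr, rinnerZl, rinnerZr).
  rewrite (selfadjoint_rinner sA (A x) x) rnorm_sqr.
  by congr (_ <= _); ring.
rewrite mulrAC mulrC ler_wpM2r//.
apply: le_trans (ler_norm _) _; apply: le_trans (rinner_le _ _) _.
by rewrite expr2 mulrA ler_wpM2r ?rnorm_ge0.
Qed.

(** Here [m] is the infimum of the numerical range, nonempty thanks to [z]. If [A - m] had an
    inverse, the bound of [|(A - m) x|^2] by a multiple of [<(A - m) x, x>] would make [A - m]
    coercive, and [m] could be increased. *)
Lemma spectrum_numinf A z : selfadjoint A -> z != 0 ->
  exists2 m : R, spectrum A m%:C &
    forall x, m * rnorm x ^+ 2 <= rinner (A x) x.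
Proof.
move=> sA z0; have [K K0 AK] := op_rnorm_bound A.
pose V := [set rinner (A x) x | x in [set x : H | rnorm x = 1]].
have u1 y : y != 0 -> rnorm ((rnorm y)^-1%:C *: y) = 1.
  move=> y0; rewrite rnormZr ger0_norm ?invr_ge0 ?rnorm_ge0// mulVf//.
  by rewrite gt_eqF// rnorm_gt0.
have Vinf : has_inf V.
  split.
    exists (rinner (A ((rnorm z)^-1%:C *: z)) ((rnorm z)^-1%:C *: z)).
    by eexists; last reflexivity; exact: u1.
  exists (- K) => _ [x /= x1 <-].
  have : `|rinner (A x) x| <= K.
    apply: le_trans (rinner_le _ _) _.
    by rewrite x1 mulr1; have := AK x; rewrite x1 mulr1.
  by rewrite ler_norml => /andP[].
pose m := inf V.
have mA x : m * rnorm x ^+ 2 <= rinner (A x) x.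
  have [->|x0] := eqVneq x 0; first by rewrite rnorm0 expr0n mulr0 rinner0r.
  have : m <= rinner (A ((rnorm x)^-1%:C *: x)) ((rnorm x)^-1%:C *: x).
    by apply: (ge_inf (proj2 Vinf)); eexists; last reflexivity; exact: u1.
  rewrite opZ rinnerZl rinnerZr mulrA -expr2 exprVn mulrC.
  by rewrite ler_pdivlMr// exprn_gt0// rnorm_gt0.
have mmax c : (forall x, c * rnorm x ^+ 2 <= rinner (A x) x) -> c <= m.
  move=> Ac; apply: lb_le_inf; first by case: Vinf.
  by move=> _ [x /= x1 <-]; have := Ac x; rewrite x1 expr1n mulr1.
exists m => //; move=> [S [SA _]].
have [|x|k k0 hk] := @positive_sqr_le (A - m%:C *: (1 : bounded_op H)).
- exact: selfadjoint_shift.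
- by rewrite !opE rinnerDl rinnerNl rinnerZl -rnorm_sqr subr_ge0.
have [s s0 hs] := op_rnorm_bound S.
suff : m + (s ^+ 2 * k)^-1 <= m.
  by rewrite leNgt ltrDl invr_gt0 mulr_gt0 ?exprn_gt0.
apply: mmax => x.
rewrite mulrDl -lerBrDl -ler_pdivlMl ?invr_gt0 ?mulr_gt0 ?exprn_gt0// invrK.
have -> : rinner (A x) x - m * rnorm x ^+ 2 =
    rinner ((A - m%:C *: (1 : bounded_op H)) x) x.
  by rewrite !opE rinnerDl rinnerNl rinnerZl -rnorm_sqr.
rewrite -mulrA; apply: le_trans (ler_wpM2l (sqr_ge0 s) (hk x)).
rewrite -exprMn ler_pXn2r ?nnegrE ?mulr_ge0 ?rnorm_ge0 ?(ltW s0)//.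
have -> : rnorm x = rnorm (S ((A - m%:C *: (1 : bounded_op H)) x)).
  by rewrite -mulopE SA oneopE.
exact: hs.
Qed.

Lemma op_poly_ge A (p : {poly R}) (c : R) : selfadjoint A ->
  (forall t : R, spectrum A t%:C -> c <= p.[t]) ->
  forall x, c * rnorm x ^+ 2 <= rinner (op_poly p A x) x.
Proof.
move=> sA pc x.
have [->|x0] := eqVneq x 0; first by rewrite rnorm0 expr0n mulr0 rinner0r.
have [m mS mA] := spectrum_numinf (op_poly_selfadjoint p sA) x0.
apply: le_trans (mA x); rewrite ler_wpM2r ?sqr_ge0//.
(* A constant [p] leaves nothing to factor; any point of the spectrum of [A] settles this case. *)
have [pm|pm] := eqVneq p m%:P.
  have [t tS _] := spectrum_numinf sA x0.
  by have := pc _ tS; rewrite pm hornerC.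
pose P := map_poly (real_complex R) (p - m%:P).
have P0 : P != 0 by rewrite map_poly_eq0 subr_eq0.
have [|l Pl lS] := @spectrum_poly A P P0.
  rewrite -op_polyE op_polyD op_polyN op_polyC => h; exact: mS.
have le := spectrum_real sA lS.
move: Pl; rewrite le fmorph_root rootE hornerD hornerN hornerC subr_eq0.
by move=> /eqP <-; apply: pc; rewrite -le.
Qed.

(** Positivity applied to [e^2 - p^2], whose quadratic form is [e^2 |x|^2 - |p(A) x|^2]. *)
Lemma op_poly_norm_le A (p : {poly R}) (e : R) : selfadjoint A -> 0 <= e ->
  (forall t : R, spectrum A t%:C -> `|p.[t]| <= e) ->
  forall x, rnorm (op_poly p A x) <= e * rnorm x.
Proof.
move=> sA e0 pe x.
rewrite -(ler_pXn2r (ltn0Sn 1)) ?nnegrE ?mulr_ge0 ?rnorm_ge0//.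
have : 0 * rnorm x ^+ 2 <= rinner (op_poly ((e ^+ 2)%:P - p * p) A x) x.
  apply: op_poly_ge => // t /pe.
  rewrite hornerD hornerN hornerM hornerC subr_ge0 -expr2 => pt.
  by rewrite -[leLHS]real_normK ?num_real// ler_pXn2r ?nnegrE.
rewrite mul0r op_polyD op_polyN op_polyM op_polyC !opE.
rewrite rinnerDl rinnerNl rinnerZl -rnorm_sqr.
rewrite (selfadjoint_rinner (op_poly_selfadjoint _ sA)) -rnorm_sqr subr_ge0.
by rewrite exprMn.
Qed.

End PolynomialCalculus.

(** * Bernstein polynomials *)

Section Weierstrass.
Context {R : realType}.

(* The Bernstein polynomial with nodes [g 0, ..., g n], by de Casteljau's
   recursion. *)
Fixpoint bernstein (n : nat) (g : nat -> R) : {poly R} :=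
  if n is m.+1 then
    (1 - 'X) * bernstein m g + 'X * bernstein m (g \o succn)
  else (g 0%N)%:P.

(* The factor of [C] in the bound is the second moment about [c] of the binomial
   law with parameters [n] and [x]. *)
Lemma bernstein_approx n (g : nat -> R) (v e C c x : R) : 0 <= x <= 1 ->
  (forall k, (k <= n)%N -> `|g k - v| <= e + C * (k%:R - c) ^+ 2) ->
  `|(bernstein n g).[x] - v| <=
    e + C * (n%:R * x * (1 - x) + (n%:R * x - c) ^+ 2).
Proof.
move=> /andP[x0 x1]; have x10 : 0 <= 1 - x by rewrite subr_ge0.
elim: n g c => [|n IH] g c gv /=.
  by rewrite hornerC; have := gv 0%N (leqnn _); rewrite mulr0n !mul0r !add0r.
rewrite !hornerE.
have -> : (1 - x) * (bernstein n g).[x] + x * (bernstein n (g \o succn)).[x] - v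
   = (1 - x) * ((bernstein n g).[x] - v)
     + x * ((bernstein n (g \o succn)).[x] - v) by ring.
apply: le_trans (ler_normD _ _) _.
rewrite !normrM (ger0_norm x0) (ger0_norm x10).
have h1 := IH g c (fun k kn => gv k (leqW kn)).
(* Shifting the nodes by one moves the centre to [c - 1]; the two second moments then combine
   exactly into that of [n + 1] trials. *)
have h2 : `|(bernstein n (g \o succn)).[x] - v| <=
    e + C * (n%:R * x * (1 - x) + (n%:R * x - (c - 1)) ^+ 2).
  apply: IH => k kn /=; have := gv k.+1 kn.
  by have -> : k.+1%:R - c = k%:R - (c - 1) by rewrite -(natr1 k); ring.
apply: le_trans (lerD (ler_wpM2l x10 h1) (ler_wpM2l x0 h2)) _.
by rewrite -(natr1 n) le_eqVlt; apply/orP; left; apply/eqP; ring.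
Qed.

(** Uniform continuity is stated with a quadratic term so that it feeds directly into the
    second-moment bound for Bernstein polynomials. *)
Lemma weierstrass (f : R -> R) (M : R) : 0 < M ->
  (forall e : R, 0 < e -> exists2 C : R, 0 <= C & forall s t : R, 0 <= s <= M ->
     0 <= t <= M -> `|f s - f t| <= e + C * (s - t) ^+ 2) ->
  forall e : R, 0 < e ->
  exists p : {poly R}, forall t : R, 0 <= t <= M -> `|p.[t] - f t| <= e.
Proof.
move=> M0 fmod e e0; have e20 : 0 < e / 2 by rewrite divr_gt0.
have [C C0 fC] := fmod _ e20.
have CM : 0 < C * M ^+ 2 + 1 by rewrite ltr_wpDl// mulr_ge0 ?sqr_ge0.
have [n hn] := ex_natSinv_le (divr_gt0 e20 CM).
have := hn n (leqnn n); set N : R := n.+1%:R => Ne.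
have N0 : 0 < N by rewrite ltr0n.
exists (bernstein n.+1 (fun k => f (M * k%:R / N)) \Po (M^-1%:P * 'X)) => t tM.
rewrite horner_comp hornerCM hornerX; set x := M^-1 * t.
have tE : t = M * x by rewrite /x mulrA divff ?mul1r ?gt_eqF.
have x01 : 0 <= x <= 1.
  case/andP: tM => t0 tM; rewrite /x mulr_ge0 ?invr_ge0 ?(ltW M0)//=.
  by rewrite ler_pdivrMl// mulr1.
(* Centred at the mean [N x], the second moment is the variance [N x (1 - x)]; since [t = M x], the
   distance from a node to [t] is [M / N] times [k - N x]. *)
have := @bernstein_approx n.+1 (fun k => f (M * k%:R / N)) (f t) (e / 2)
  (C * M ^+ 2 / N ^+ 2) (N * x) x x01.
rewrite -/N => h; apply: le_trans (h _) _ => [k kn|].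
  apply: le_trans (fC _ _ _ tM) _.
    rewrite divr_ge0 ?mulr_ge0 ?(ltW M0) ?(ltW N0)//=.
    by rewrite ler_pdivrMr// ler_pM2l// ler_nat.
  rewrite lerD2l tE le_eqVlt; apply/orP; left; apply/eqP; field.
  by rewrite gt_eqF.
rewrite subrr expr0n addr0.
have -> : C * M ^+ 2 / N ^+ 2 * (N * x * (1 - x)) =
    N^-1 * (C * M ^+ 2) * (x * (1 - x)) by field; rewrite gt_eqF.
move: Ne; rewrite ler_pdivlMr// => Ne.
have {}Ne : N^-1 * (C * M ^+ 2) <= e / 2.
  by apply: le_trans Ne; rewrite ler_pM2l ?invr_gt0// lerDl.
have q0 : 0 <= N^-1 * (C * M ^+ 2).
  by rewrite mulr_ge0 ?invr_ge0 ?(ltW N0)// mulr_ge0 ?sqr_ge0.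
case/andP: x01 => x0 x1; move: q0 Ne; move: (_ * _) => q q0 Ne.
clear -x0 x1 q0 Ne.
have : x * (1 - x) <= 1 by nra.
have : 0 <= x * (1 - x) by nra.
by move: (x * _) => y y0 y1; nra.
Qed.

(** With [d] the difference of the roots, [d^2 <= |s - t|]; so either [d <= e], or
    [d <= d^4 / e^3 <= (s - t)^2 / e^3]. *)
Lemma sqrt_modulus (M e : R) : 0 < e -> exists2 C : R, 0 <= C & forall s t : R,
  0 <= s <= M -> 0 <= t <= M ->
  `|Num.sqrt s - Num.sqrt t| <= e + C * (s - t) ^+ 2.
Proof.
move=> e0; exists (e ^+ 3)^-1; first by rewrite invr_ge0 exprn_ge0 ?ltW.
move=> s t /andP[s0 _] /andP[t0 _].
set d := `|_|; have d0 : 0 <= d by exact: normr_ge0.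
have [de|ed] := leP d e.
  by rewrite ler_wpDr// mulr_ge0 ?sqr_ge0// invr_ge0 exprn_ge0 ?ltW.
have dst : (d ^+ 2) ^+ 2 <= (s - t) ^+ 2.
  rewrite -[leRHS]real_normK ?num_real// ler_pXn2r ?nnegrE ?sqr_ge0//.
  rewrite -[in leRHS](sqr_sqrtr s0) -[in leRHS](sqr_sqrtr t0) subr_sqr normrM.
  rewrite expr2 ler_wpM2l//; apply: le_trans (ler_normB _ _) _.
  by rewrite !ger0_norm ?addr_ge0 ?sqrtr_ge0.
rewrite ler_wpDl ?(ltW e0)//.
rewrite ler_pdivlMl ?exprn_gt0//; apply: le_trans dst.
rewrite -exprM (exprSr d 3) ler_wpM2r// ler_pXn2r ?nnegrE ?(ltW e0)//.
exact: ltW.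
Qed.

End Weierstrass.

(** * Convex functions on the half-line *)

Section Convex.
Context {R : realType} (phi : R -> R).

Definition nneg_convex := forall t a b : R, 0 <= t <= 1 -> 0 <= a -> 0 <= b ->
  phi (t * a + (1 - t) * b) <= t * phi a + (1 - t) * phi b.

Lemma orlicz_nneg_convex : orlicz phi -> nneg_convex.
Proof.
move=> ophi t a b t01 a0 b0.
have := orlicz_convex ophi (Itv01 (proj1 (andP t01)) (proj2 (andP t01))).
move=> /(_ a b); apply; rewrite inE /= in_itv/= andbT//.
Qed.

Lemma orlicz_homo : orlicz phi ->
  forall s t : R, 0 <= s -> s <= t -> phi s <= phi t.
Proof.
move=> ophi s t s0 st; apply: (orlicz_increasing ophi) => //.
  by rewrite in_itv/= s0.
by rewrite in_itv/= (le_trans s0).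
Qed.

Hypothesis cphi : nneg_convex.

(** Monotonicity of chord slopes, cleared of denominators; [b] is the convex combination of [a] and
    [c] with weight [(c - b) / (c - a)] on [a]. *)
Lemma convex_slope (a b c : R) : 0 <= a -> a < b -> b < c ->
  (phi b - phi a) * (c - b) <= (phi c - phi b) * (b - a).
Proof.
move=> a0 ab bc; have ca : 0 < c - a by rewrite subr_gt0 (lt_trans ab).
have := @cphi ((c - b) / (c - a)) a c.
have -> : (c - b) / (c - a) * a + (1 - (c - b) / (c - a)) * c = b.
  by field; rewrite gt_eqF.
have -> : (c - b) / (c - a) * phi a + (1 - (c - b) / (c - a)) * phi c =
   ((c - b) * phi a + (b - a) * phi c) / (c - a) by field; rewrite gt_eqF.
move=> h; have : phi b <= ((c - b) * phi a + (b - a) * phi c) / (c - a).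
  apply: h => //; last exact: le_trans a0 (ltW (lt_trans ab bc)).
  rewrite divr_ge0 ?subr_ge0 ?(ltW bc) ?(ltW (lt_trans ab bc))//=.
  by rewrite ler_pdivrMr// mul1r lerD2l lerN2 ltW.
by rewrite ler_pdivlMr//; lra.
Qed.

Hypothesis phi_homo : forall s t : R, 0 <= s -> s <= t -> phi s <= phi t.

(** The slope [k] is the supremum of the chord slopes on the left of [v]. At [v = 0] there is no
    such chord, and monotonicity allows [k = 0]. *)
Lemma convex_subgradient (v : R) : 0 <= v ->
  exists k : R, forall t : R, 0 <= t -> phi v + k * (t - v) <= phi t.
Proof.
rewrite le_eqVlt => /orP[/eqP <-|v0].
  by exists 0 => t t0; rewrite mul0r addr0 phi_homo.
pose V := [set (phi v - phi s) / (v - s) | s in [set s : R | 0 <= s < v]].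
have Vub c : v < c -> ubound V ((phi c - phi v) / (c - v)).
  move=> vc _ [s /= /andP[s0 sv] <-].
  rewrite ler_pdivrMr ?subr_gt0// mulrAC ler_pdivlMr ?subr_gt0//.
  exact: convex_slope.
have V0 : V !=set0.
  by exists ((phi v - phi 0) / (v - 0)), 0; rewrite //= lexx v0.
have Vsup : has_sup V.
  split => //; exists ((phi (v + 1) - phi v) / (v + 1 - v)).
  by apply: Vub; rewrite ltrDl.
exists (sup V) => t t0.
have [tv|vt|->] := ltgtP t v; last by rewrite subrr mulr0 addr0.
  have : (phi v - phi t) / (v - t) <= sup V.
    by apply: sup_upper_bound => //; exists t; rewrite //= t0 tv.
  by rewrite ler_pdivrMr ?subr_gt0//; lra.
have : sup V <= (phi t - phi v) / (t - v) by apply: ge_sup => //; exact: Vub.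
by rewrite ler_pdivlMr ?subr_gt0//; lra.
Qed.

(** The supporting line at [t], evaluated at [t + 1], bounds its slope by [phi (M + 1) - phi 0];
    evaluated at [s < t], it bounds [phi t - phi s]. *)
Lemma convex_lipschitz (M : R) : 0 <= M -> exists2 L : R, 0 <= L & forall s t,
  0 <= s <= M -> 0 <= t <= M -> `|phi s - phi t| <= L * `|s - t|.
Proof.
move=> M0; pose L := phi (M + 1) - phi 0.
have L0 : 0 <= L by rewrite subr_ge0 phi_homo// addr_ge0.
have key s t : 0 <= s -> s < t -> t <= M -> phi t - phi s <= L * (t - s).
  move=> s0 st tM; have t0 : 0 <= t := le_trans s0 (ltW st).
  have [k hk] := convex_subgradient t0.
  have := hk _ s0; have := hk (t + 1) (addr_ge0 t0 ler01).
  have := phi_homo (lexx 0) t0.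
  have : phi (t + 1) <= phi (M + 1) by rewrite phi_homo ?addr_ge0// lerD2r.
  have : 0 < t - s by rewrite subr_gt0.
  rewrite /L; nra.
exists L => // s t /andP[s0 sM] /andP[t0 tM].
have [st|ts|->] := ltgtP s t; last by rewrite !subrr !normr0 mulr0.
  rewrite distrC ger0_norm ?subr_ge0 ?phi_homo ?(ltW st)//.
  by rewrite distrC ger0_norm ?subr_ge0 ?(ltW st)// key.
rewrite ger0_norm ?subr_ge0 ?phi_homo ?(ltW ts)//.
by rewrite ger0_norm ?subr_ge0 ?(ltW ts)// key.
Qed.

(** The weighted sum of the supporting-line inequalities at the barycentre, where the linear terms
    cancel. *)
Lemma nneg_convex_comb3 (a b c u v w : R) :
  0 <= a -> 0 <= b -> 0 <= c -> a + b + c = 1 ->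
  0 <= u -> 0 <= v -> 0 <= w ->
  phi (a * u + b * v + c * w) <= a * phi u + b * phi v + c * phi w.
Proof.
move=> a0 b0 c0 abc u0 v0 w0.
have s0 : 0 <= a * u + b * v + c * w by rewrite !addr_ge0 ?mulr_ge0.
have [k hk] := convex_subgradient s0.
have := ler_wpM2l a0 (hk _ u0); have := ler_wpM2l b0 (hk _ v0).
have := ler_wpM2l c0 (hk _ w0).
set s := a * u + _ + _; move: (phi s) (phi u) (phi v) (phi w) => ps pu pv pw.
move=> h1 h2 h3.
have -> : ps = (a + b + c) * ps + k * (s - (a + b + c) * s).
  by rewrite abc !mul1r subrr mulr0 addr0.
have -> : (a + b + c) * ps + k * (s - (a + b + c) * s) =
  a * (ps + k * (u - s)) + b * (ps + k * (v - s)) + c * (ps + k * (w - s)).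
  by rewrite /s; ring.
by rewrite !lerD.
Qed.

End Convex.

(** * Continuous functional calculus *)

Section FunctionalCalculus.
Context {R : realType} {H : hilbertType R}.
Implicit Types (x y z : H) (S T U A B : bounded_op H) (f : R -> R).

(** Both convergences unfolded into epsilon bounds, with the operator norm replaced by a bound at
    every vector. *)
Lemma is_cfcP f A B : is_cfc f A B <-> exists p : nat -> {poly R},
  (forall e : R, 0 < e -> exists N, forall n, (N <= n)%N ->
     forall t : R, spectrum A t%:C -> `|(p n).[t] - f t| <= e) /\
  (forall e : R, 0 < e -> exists N, forall n, (N <= n)%N ->
     forall x, rnorm ((op_poly (p n) A - B) x) <= e * rnorm x).
Proof.
split=> [[p pf pB]|[p [pf pB]]]; exists p.
- split=> e e0.
    pose P := [set h : R -> R |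
      forall t : R, spectrum A t%:C -> `|h t - f t| <= e].
    have : nbhs (f : {uniform` [set t : R | spectrum A t%:C] -> R}) P.
      apply/uniform_nbhs.
      exists [set xy : R * R | ball xy.1 e xy.2]; split.
        exact: (entourage_ball _ (PosNum e0)).
      move=> h fh t /fh; rewrite /= -ball_normE /ball_/= distrC => /ltW; exact.
    by move=> /pf [N _ hN]; exists N => n /hN.
  have /cvgrPdist_le/(_ _ e0)[N _ hN] := pB; exists N => n Nn x.
  have pe : opnorm (op_poly (p n) A - B) <= e.
    by have := hN n Nn; rewrite sub0r normrN ger0_norm ?opnorm_ge0.
  by apply: le_trans (opnorm_bound _ _) _; rewrite ler_wpM2r// rnorm_ge0.
- move=> P /uniform_nbhs[E [entE EP]].
  have [e e0 eE] : exists2 e : R, 0 < e & [set xy | ball xy.1 e xy.2] `<=` E.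
    by move: entE; rewrite -entourage_ballE => -[e /= e0 eE]; exists e.
  have e20 : 0 < e / 2 by rewrite divr_gt0.
  have [N hN] := pf _ e20; exists N => // n /hN pn /=.
  apply: EP => t /pn tn; apply: eE; rewrite /= -ball_normE /ball_/= distrC.
  by apply: le_lt_trans tn _; rewrite ltr_pdivrMr// ltr_pMr// ltr1n.
apply/cvgrPdist_le => e e0; have [N hN] := pB _ e0; exists N => // n /hN pn /=.
by rewrite sub0r normrN ger0_norm ?opnorm_ge0// opnorm_le// ltW.
Qed.

Lemma op_complete (U : nat -> bounded_op H) :
  (forall e : R, 0 < e -> exists N, forall m n, (N <= m)%N -> (N <= n)%N ->
     forall x, rnorm ((U m - U n) x) <= e * rnorm x) ->
  exists B, forall e : R, 0 < e -> exists N, forall n, (N <= n)%N ->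
     forall x, rnorm ((U n - B) x) <= e * rnorm x.
Proof.
move=> cU.
have /choice[l ul] : forall x, exists l, forall e : R, 0 < e -> exists N,
    forall n, (N <= n)%N -> rnorm (U n x - l) <= e.
  move=> x; apply: rnorm_complete => e e0.
  have r0 : 0 < rnorm x + 1 by rewrite ltr_wpDl ?rnorm_ge0.
  have [N hN] := cU _ (divr_gt0 e0 r0); exists N => m n Nm Nn.
  apply: le_trans (hN _ _ Nm Nn x) _.
  by rewrite mulrAC ler_pdivrMr// ler_pM2l// lerDl.
have unif e : 0 < e -> exists N, forall n, (N <= n)%N ->
    forall x, rnorm (U n x - l x) <= e * rnorm x.
  move=> e0; have [N hN] := cU _ e0; exists N => n Nn x.
  apply/ler_addgt0Pr => d d0; have [N' hN'] := ul x _ d0.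
  have -> : U n x - l x = (U n x - U (maxn N N') x) + (U (maxn N N') x - l x).
    by rewrite addrA subrK.
  apply: le_trans (rnormD _ _) _; rewrite lerD ?hN' ?leq_maxr//.
  by apply: hN => //; exact: leq_maxl.
have ll : linear l.
  move=> a u v; apply/eqP; rewrite -subr_eq0; apply/eqP/rnorm_eq0.
  apply: (@le_epsM_eq0 _ _
    (rnorm (a *: u + v) + (complex.Re `|a| * rnorm u + rnorm v))) => e e0.
  rewrite ger0_norm ?rnorm_ge0//.
  have [N /(_ N (leqnn N)) hN] := unif _ e0.
  have -> : l (a *: u + v) - (a *: l u + l v) =
      - (U N (a *: u + v) - l (a *: u + v)) +
      (a *: (U N u - l u) + (U N v - l v)).
    rewrite opD opZ scalerBr opprB -addrA; congr (_ + _).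
    by rewrite addrACA -opprD addrA addNr add0r.
  apply: le_trans (rnormD _ _) _; rewrite mulrDr lerD ?rnormN//.
  apply: le_trans (rnormD _ _) _.
  rewrite mulrDr lerD// rnormZ mulrCA ler_wpM2l//.
  by rewrite -ler0c RRe_real ?ger0_real.
have [N /(_ N (leqnn N)) hN] := unif _ ltr01.
have [K K0 UK] := op_rnorm_bound (U N).
have [|B Bl] := @op_of_bound _ _ l (K + 1) ll.
  move=> x; rewrite -[l x](subKr (U N x)) mulrDl.
  by apply: le_trans (rnormD _ _) _; rewrite rnormN lerD.
by exists B => e /unif[M hM]; exists M => n /hM Un x; rewrite !opE Bl.
Qed.

Lemma is_cfc_exists f A (M : R) : selfadjoint A -> 0 < M ->
  (forall t : R, spectrum A t%:C -> 0 <= t <= M) ->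
  (forall e : R, 0 < e -> exists2 C : R, 0 <= C & forall s t : R, 0 <= s <= M ->
     0 <= t <= M -> `|f s - f t| <= e + C * (s - t) ^+ 2) ->
  exists B, is_cfc f A B.
Proof.
move=> sA M0 AM fmod.
have /choice[p pf] : forall n : nat, exists p : {poly R},
    forall t : R, 0 <= t <= M -> `|p.[t] - f t| <= n.+1%:R^-1.
  by move=> n; apply: (weierstrass M0 fmod); rewrite invr_gt0.
have pfe e : 0 < e -> exists N, forall n, (N <= n)%N ->
    forall t : R, spectrum A t%:C -> `|(p n).[t] - f t| <= e.
  move=> e0; have [N hN] := ex_natSinv_le e0; exists N => n /hN ne t /AM tM.
  by apply: le_trans ne; exact: pf.
have [e e0|B UB] := @op_complete (fun n => op_poly (p n) A).
  have [N hN] := pfe _ (divr_gt0 e0 (ltr0Sn _ 1)); exists N => i j Ni Nj.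
  rewrite -op_polyN -op_polyD; apply: op_poly_norm_le => //; first exact: ltW.
  move=> t tS; rewrite hornerD hornerN.
  have -> : (p i).[t] - (p j).[t] =
      ((p i).[t] - f t) - ((p j).[t] - f t) by ring.
  apply: le_trans (ler_normB _ _) _.
  by rewrite [leRHS]splitr lerD// hN.
by exists B; apply/is_cfcP; exists p.
Qed.

Lemma is_cfc_cfc f A : (exists B, is_cfc f A B) -> is_cfc f A (cfc f A).
Proof. by move=> [B AB]; rewrite /cfc; case: xgetP => [C _ //|/(_ B)]. Qed.

(** Up to a small error the approximants [p n] dominate [q] on the spectrum; positivity applies to
    [p n - q], and the inequality survives the norm limit. *)
Lemma is_cfc_ge_poly f A B (q : {poly R}) : selfadjoint A -> is_cfc f A B ->
  (forall t : R, spectrum A t%:C -> q.[t] <= f t) ->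
  forall x, rinner (op_poly q A x) x <= rinner (B x) x.
Proof.
move=> sA /is_cfcP[p [pf pB]] qf x.
apply/ler_addgt0Pr => d d0.
pose e := d / 2 / (rnorm x ^+ 2 + 1).
have r0 : 0 < rnorm x ^+ 2 + 1 by rewrite ltr_wpDl ?sqr_ge0.
have e0 : 0 < e by rewrite !divr_gt0.
have [N1 h1] := pf _ e0; have [N2 h2] := pB _ e0; pose n := maxn N1 N2.
have pq : - e * rnorm x ^+ 2 <= rinner (op_poly (p n - q) A x) x.
  apply: op_poly_ge => // t tS; rewrite hornerD hornerN.
  have := h1 n (leq_maxl _ _) t tS; have := qf t tS.
  by rewrite ler_norml => ? /andP[? _]; lra.
have pBx : `|rinner ((op_poly (p n) A - B) x) x| <= e * rnorm x ^+ 2.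
  apply: le_trans (rinner_le _ _) _.
  by rewrite expr2 mulrA ler_wpM2r ?rnorm_ge0// h2// leq_maxr.
have ed : e * rnorm x ^+ 2 <= d / 2.
  by rewrite /e mulrAC ler_pdivrMr// ler_pM2l ?divr_gt0// lerDl.
move: pq pBx; rewrite op_polyD op_polyN !opE !rinnerDl !rinnerNl ler_norml.
by move=> pq /andP[_]; lra.
Qed.

Lemma cfc_sqrt_sqr A B : selfadjoint A -> (forall x, 0 <= rinner (A x) x) ->
  is_cfc Num.sqrt A B -> B * B = A.
Proof.
move=> sA A0 /is_cfcP[p [pf pB]].
have [K K0 AK] := op_rnorm_bound A.
have [b b0 Bb] := op_rnorm_bound B.
have SA t : spectrum A t%:C -> 0 <= t <= K.
  move=> tS; rewrite (spectrum_ge sA _ tS) ?(spectrum_le sA _ tS)//.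
    move=> x; apply: le_trans (ler_norm _) _; apply: le_trans (rinner_le _ _) _.
    by rewrite expr2 mulrA ler_wpM2r ?rnorm_ge0.
  by move=> x; rewrite mul0r.
apply: op_ext => x; apply/eqP; rewrite -subr_eq0; apply/eqP/rnorm_eq0.
rewrite mulopE.
(* The error of [P^2] against [A] contributes [1 + 2 sqrt K]; replacing [P^2] by [B^2] contributes
   [b + 1] and [b]. *)
apply: (@le_epsM_eq0 _ _
  ((1 + 2 * Num.sqrt K + (b + 1) + b) * rnorm x)) => e' e'0.
rewrite ger0_norm ?rnorm_ge0//.
(* Capping [e] at 1 bounds [P] by [b + 1] and [p + sqrt] by [1 + 2 sqrt K], independently of [e]. *)
pose e := Num.min e' 1; have e0 : 0 < e by rewrite lt_min e'0 ltr01.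
have e1 : e <= 1 by rewrite ge_min lexx orbT.
have C0 : 0 <= (1 + 2 * Num.sqrt K + (b + 1) + b) * rnorm x.
  rewrite mulr_ge0 ?rnorm_ge0//; have := sqrtr_ge0 K; move: b0; clear; lra.
apply: (@le_trans _ _ (e * ((1 + 2 * Num.sqrt K + (b + 1) + b) * rnorm x))).
  2: by rewrite ler_wpM2r// ge_min lexx.
have [N1 h1] := pf _ e0; have [N2 h2] := pB _ e0; pose n := maxn N1 N2.
pose P := op_poly (p n) A.
have PB y : rnorm (P y - B y) <= e * rnorm y := h2 n (leq_maxr _ _) y.
have Pb y : rnorm (P y) <= (b + 1) * rnorm y.
  rewrite -[P y](subrK (B y)) addrC mulrDl.
  apply: le_trans (rnormD _ _) _; rewrite lerD// mul1r.
  by apply: le_trans (PB y) _; rewrite ler_piMl ?rnorm_ge0.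
have PA : rnorm (P (P x) - A x) <= e * (1 + 2 * Num.sqrt K) * rnorm x.
  have -> : P (P x) - A x = op_poly (p n * p n - 'X) A x.
    by rewrite op_polyD op_polyN op_polyM op_polyX.
  apply: op_poly_norm_le => //.
    by rewrite mulr_ge0 ?(ltW e0)// addr_ge0// mulr_ge0// sqrtr_ge0.
  move=> t tS; rewrite hornerD hornerN hornerM hornerX.
  have /andP[t0 tK] := SA t tS.
  rewrite -[X in _ - X](sqr_sqrtr t0) -expr2 subr_sqr normrM.
  have pt := h1 n (leq_maxl _ _) t tS.
  apply: ler_pM => //.
  have -> : (p n).[t] + Num.sqrt t = ((p n).[t] - Num.sqrt t) + 2 * Num.sqrt t.
    by ring.
  apply: le_trans (ler_normD _ _) _; apply: lerD; first exact: le_trans e1.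
  by rewrite normrM ger0_norm// ger0_norm ?sqrtr_ge0// ler_pM2l// ler_wsqrtr.
have -> : B (B x) - A x =
    (P (P x) - A x) - (P (P x - B x) + (P (B x) - B (B x))).
  rewrite opD opN addrA subrK opprB [RHS]addrC addrA subrK.
  by [].
have -> : e * ((1 + 2 * Num.sqrt K + (b + 1) + b) * rnorm x) =
  e * (1 + 2 * Num.sqrt K) * rnorm x +
  ((b + 1) * (e * rnorm x) + e * (b * rnorm x)) by ring.
apply: le_trans (rnormD _ _) _; rewrite rnormN lerD//.
apply: le_trans (rnormD _ _) _; apply: lerD.
  apply: le_trans (Pb _) _; rewrite ler_wpM2l//.
  by rewrite addr_ge0// ltW.
by apply: le_trans (PB _) _; rewrite ler_wpM2l// ltW.
Qed.

(** The polynomial [q] is the supporting line of [phi] at [<A x, x>]; for a unit vector,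
    [<q(A) x, x>] is the value of [phi] at that point. *)
Lemma cfc_jensen (phi : R -> R) A B : nneg_convex phi ->
  (forall s t : R, 0 <= s -> s <= t -> phi s <= phi t) ->
  selfadjoint A -> (forall x, 0 <= rinner (A x) x) -> is_cfc phi A B ->
  forall x, rnorm x = 1 -> phi (rinner (A x) x) <= rinner (B x) x.
Proof.
move=> cphi hphi sA A0 AB x x1.
have [k hk] := convex_subgradient cphi hphi (A0 x).
pose q := (phi (rinner (A x) x) - k * rinner (A x) x)%:P + k%:P * 'X.
have := @is_cfc_ge_poly phi A B q sA AB _ x.
rewrite op_polyD op_polyM !op_polyC op_polyX !opE rinnerDl !rinnerZl.
rewrite -rnorm_sqr x1 expr1n mulr1 subrK; apply=> t tS.
rewrite hornerD hornerC hornerCM hornerX.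
have : 0 <= t by apply: (spectrum_ge sA _ tS) => y; rewrite mul0r.
by move=> /hk; lra.
Qed.

End FunctionalCalculus.

(** * Numerical radius *)

Section NumericalRadius.
Context {R : realType} {H : hilbertType R}.
Implicit Types (x y z : H) (S T U A B : bounded_op H) (f : R -> R).

(** * The positive operator [T^* T] and the modulus of [T] *)

Lemma selfadjoint_gram T : selfadjoint (adjoint T * T).
Proof.
by move=> x y; rewrite !opE -adjointP innerC -adjointP -innerC.
Qed.

Lemma rinner_gram T x : rinner ((adjoint T * T) x) x = rnorm (T x) ^+ 2.
Proof. by rewrite rinnerC rnorm_sqr /rinner -adjointP. Qed.

Lemma gram_ge0 T x : 0 <= rinner ((adjoint T * T) x) x.
Proof. by rewrite rinner_gram sqr_ge0. Qed.

Lemma gram_spectrum T : exists2 M : R, 0 < M &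
  forall t : R, spectrum (adjoint T * T) t%:C -> 0 <= t <= M.
Proof.
have [K K0 TK] := op_rnorm_bound T; exists (K ^+ 2); first exact: exprn_gt0.
move=> t tS; rewrite (spectrum_ge (@selfadjoint_gram T) _ tS).
  apply: (spectrum_le (@selfadjoint_gram T) _ tS) => x.
  rewrite rinner_gram -exprMn.
  by rewrite ler_pXn2r ?nnegrE ?mulr_ge0 ?rnorm_ge0 ?(ltW K0).
by move=> x; rewrite mul0r gram_ge0.
Qed.

Lemma absop_sqr T : absop T ^+ 2 = adjoint T * T.
Proof.
have [M M0 SM] := gram_spectrum T; have sT := @selfadjoint_gram T.
rewrite expr2; apply: cfc_sqrt_sqr => //; first exact: gram_ge0.
apply: is_cfc_cfc; apply: (is_cfc_exists sT M0 SM) => e.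
exact: sqrt_modulus.
Qed.

Lemma cfc_gram_jensen (phi : R -> R) T : nneg_convex phi ->
  (forall s t : R, 0 <= s -> s <= t -> phi s <= phi t) ->
  forall x, rnorm x = 1 ->
  phi (rnorm (T x) ^+ 2) <= rinner (cfc phi (absop T ^+ 2) x) x.
Proof.
move=> cphi hphi x x1; have [M M0 SM] := gram_spectrum T.
have sT := @selfadjoint_gram T.
rewrite absop_sqr -rinner_gram; apply: cfc_jensen => //; first exact: gram_ge0.
apply: is_cfc_cfc; apply: (is_cfc_exists sT M0 SM) => e e0.
have [L L0 hL] := convex_lipschitz cphi hphi (ltW M0).
(* From [(2 e - L u)^2 >= 0] one gets [L u <= e + L^2 u^2 / (4 e)]. *)
exists (L ^+ 2 / (4 * e)); first by rewrite divr_ge0 ?sqr_ge0// mulr_ge0 ?ltW.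
move=> s t sM tM; apply: le_trans (hL s t sM tM) _.
rewrite -(real_normK (num_real (s - t))).
move: `|s - t| => u; rewrite -(ler_pM2r (_ : 0 < 4 * e)) ?mulr_gt0//.
have -> : (e + L ^+ 2 / (4 * e) * u ^+ 2) * (4 * e) =
   4 * e ^+ 2 + L ^+ 2 * u ^+ 2 by field; rewrite gt_eqF.
have := sqr_ge0 (2 * e - L * u); clear; nra.
Qed.

(* [2 <a, x> x - a] is the reflection of [a] in the line spanned by [x]. *)
Lemma buzano (a b x : H) : rnorm x = 1 ->
  complex.Re `|inner a x * inner x b| <=
    2^-1 * (rnorm a * rnorm b + complex.Re `|inner a b|).
Proof.
move=> x1; pose r := (2 * inner a x) *: x - a.
have xx : inner x x = 1.
  by rewrite -sqr_normr_inner normr_rnorm x1 -rmorphXn expr1n.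
have rr : rnorm r = rnorm a.
  apply/eqP; rewrite -(eqrXn2 (ltn0Sn 1)) ?rnorm_ge0// !rnorm_sqr /rinner.
  rewrite /r !(linearBl, linearBr, linearZl_LR, linearZr_LR)/= xx (innerC x a).
  rewrite rmorphM/= rmorph_nat -[(inner a x)^*%C]/(Num.conj (inner a x)).
  rewrite -![_ *: _]/(_ * _).
  by move: (Num.conj _) => c'; apply/eqP; congr complex.Re; ring.
have e : inner a x * inner x b = (2^-1)%:C * (inner r b + inner a b).
  rewrite /r linearBl linearZl_LR/= subrK !mulrA.
  by rewrite (_ : (2^-1)%:C * 2 = 1) ?mul1r// fmorphV/= rmorph_nat mulVf.
have ReM (u : R) (z : R[i]) : complex.Re `|u%:C * z| = `|u| * complex.Re `|z|.
  rewrite normrM normc_def/= expr0n addr0 sqrtr_sqr.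
  by case: (Num.norm z) => p q /=; rewrite mul0r subr0.
rewrite e ReM (ger0_norm (_ : 0 <= 2^-1 :> R)) ?invr_ge0//.
rewrite ler_wpM2l ?invr_ge0//.
apply: (@le_trans _ _ (complex.Re `|inner r b| + complex.Re `|inner a b|)).
  have := ler_normD (inner r b) (inner a b).
  by rewrite lecE => /andP[_]; rewrite raddfD.
by rewrite lerD2r -rr inner_le.
Qed.

(** * Pointwise values and the numerical radius *)

Definition numval T x : R := complex.Re `|inner (T x) x|.

Lemma numval_ge0 T x : 0 <= numval T x.
Proof. by rewrite -ler0c RRe_real ?ger0_real. Qed.

Lemma numrad_has_ubound T :
  has_ubound [set complex.Re `|inner (T x) x| | x in [set x : H | `|x| = 1]].
Proof.
have [K K0 TK] := op_rnorm_bound T; exists K => _ [x /= x1 <-].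
have {}x1 : rnorm x = 1 by rewrite /rnorm x1.
apply: le_trans (inner_le _ _) _; rewrite x1 mulr1.
by have := TK x; rewrite x1 mulr1.
Qed.

Lemma numrad_ge0 T : 0 <= numrad T.
Proof.
have := @numrad_has_ubound T; rewrite /numrad; set V := [set _ | _ in _] => ubV.
(* The zero space has no unit vector, and the supremum of the empty set is 0. *)
have [->|/set0P[y Vy]] := eqVneq V set0; first by rewrite sup0.
apply: le_trans (ub_le_sup ubV Vy); case: Vy => x _ <-; exact: numval_ge0.
Qed.

Lemma numval_le T x : rnorm x = 1 -> numval T x <= numrad T.
Proof.
move=> x1; apply: (ub_le_sup (numrad_has_ubound T)); exists x => //=.
by rewrite normr_rnorm x1.
Qed.

Lemma numval_le_norm T x : rnorm x = 1 -> numval T x <= rnorm (T x).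
Proof. by move=> x1; have := inner_le (T x) x; rewrite x1 mulr1. Qed.

Lemma numval_adjoint T x : numval (adjoint T) x = numval T x.
Proof.
rewrite /numval innerC -adjointP; congr complex.Re.
exact: norm_conjC.
Qed.

(** Buzano's inequality for [T x] and [T^* x], whose inner product is [<T^2 x, x>], followed by the
    arithmetic-geometric mean inequality. *)
Lemma numval_sqr_le T x : rnorm x = 1 ->
  numval T x ^+ 2 <=
    2^-1 * numval (T ^+ 2) x +
    4^-1 * (rnorm (T x) ^+ 2 + rnorm (adjoint T x) ^+ 2).
Proof.
move=> x1; have := @buzano (T x) (adjoint T x) x x1.
rewrite -!adjointP -[T (T x)]/((T * T) x) -expr2 -/(numval (T ^+ 2) x).
have -> : complex.Re `|inner (T x) x * inner (T x) x| = numval T x ^+ 2.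
  by rewrite /numval normrM normc_def -rmorphM/= expr2.
move=> h; apply: le_trans h _.
have := sqr_ge0 (rnorm (T x) - rnorm (adjoint T x)); nra.
Qed.

Lemma opnorm_comb_ge (a b p q : R) A B x : rnorm x = 1 -> 0 <= a -> 0 <= b ->
  p <= rinner (A x) x -> q <= rinner (B x) x ->
  a * p + b * q <= opnorm (a%:C *: A + b%:C *: B).
Proof.
move=> x1 a0 b0 pA qB; set D := _ + _ : bounded_op H.
apply: (@le_trans _ _ (rinner (D x) x)).
  by rewrite /D !opE rinnerDl !rinnerZl lerD// ler_wpM2l.
apply: le_trans (ler_norm _) _; apply: le_trans (rinner_le _ _) _.
by have := opnorm_bound D x; rewrite x1 !mulr1.
Qed.

(** The operator [S] stands for [T] or its adjoint so that one proof covers both inequalities: the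
    numerical values of [T] are unchanged and the two moduli are exchanged. *)
Lemma orlicz_numrad_le (phi : R -> R) (alpha : R) T S : orlicz phi ->
  0 <= alpha <= 1 -> S = T \/ S = adjoint T ->
  phi (numrad T ^+ 2) <=
    alpha / 2 * phi (numrad (T ^+ 2)) +
    opnorm ((alpha / 4)%:C *: cfc phi (absop S ^+ 2) +
            (1 - 3 * alpha / 4)%:C *: cfc phi (absop (adjoint S) ^+ 2)).
Proof.
move=> ophi /andP[al0 al1] ST; set rhs := (X in _ <= X).
have hphi := orlicz_homo ophi; have cphi := orlicz_nneg_convex ophi.
have rhs0 : 0 <= rhs.
  rewrite addr_ge0 ?opnorm_ge0// mulr_ge0 ?divr_ge0//.
  exact/(orlicz_ge0 ophi)/numrad_ge0.
have pt x : rnorm x = 1 -> phi (numval T x ^+ 2) <= rhs.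
  move=> x1.
  pose A := rnorm (S x) ^+ 2; pose B := rnorm (adjoint S x) ^+ 2.
  have hB : numval T x ^+ 2 <= B.
    rewrite ler_pXn2r ?nnegrE ?numval_ge0 ?rnorm_ge0//.
    rewrite (_ : numval T x = numval (adjoint S) x) ?numval_le_norm//.
    by case: ST => ->; rewrite ?adjointK// numval_adjoint.
  have hAB : numval T x ^+ 2 <= 2^-1 * numval (T ^+ 2) x + 4^-1 * (A + B).
    rewrite /A /B; case: ST => ->; rewrite ?adjointK.
      exact: numval_sqr_le.
    by rewrite [_ + rnorm (T x) ^+ 2]addrC; exact: numval_sqr_le.
  (* Adding [alpha] times [hAB] and [1 - alpha] times [hB] gives [B] the coefficient
     [alpha / 4 + 1 - alpha]; the three weights sum to 1. *)
  apply: (@le_trans _ _ (phi (alpha / 2 * numval (T ^+ 2) x + alpha / 4 * A +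
      (1 - 3 * alpha / 4) * B))).
    by apply: hphi; [exact: sqr_ge0|nra].
  apply: le_trans (nneg_convex_comb3 cphi hphi _ _ _ _ _ _ _) _.
  - by rewrite divr_ge0.
  - by rewrite divr_ge0.
  - lra.
  - lra.
  - exact: numval_ge0.
  - exact: sqr_ge0.
  - exact: sqr_ge0.
  rewrite -addrA lerD//.
    rewrite ler_wpM2l ?divr_ge0// hphi ?numval_ge0//; exact: numval_le.
  by apply: (opnorm_comb_ge x1);
    [rewrite divr_ge0 | lra | exact: cfc_gram_jensen | exact: cfc_gram_jensen].
pose V := [set complex.Re `|inner (T x) x| | x in [set x : H | `|x| = 1]].
have [E0|/set0P E0] := eqVneq V set0.
  by rewrite /numrad -/V E0 sup0 expr0n (orlicz0 ophi).
pose w := numrad T; have w0 : 0 <= w := numrad_ge0 T.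
(* The pointwise bound passes to the supremum because [phi] is Lipschitz on [[0, w^2]]: as
   [w^2 - s^2 <= 2 w (w - s)], a unit vector with deficit below [d / (2 L w + 1)] costs at most
   [d]. *)
have [L L0 hL] := convex_lipschitz cphi hphi (sqr_ge0 w).
apply/ler_addgt0Pr => d d0.
have C0 : 0 < L * (2 * w) + 1 by rewrite ltr_wpDl// !mulr_ge0.
have [_ [x x1 <-] sx] := sup_adherent (divr_gt0 d0 C0)
  (conj E0 (numrad_has_ubound T)).
have {}x1 : rnorm x = 1 by rewrite /rnorm (x1 : `|x| = 1).
move: sx; rewrite -/(numrad T) -/w -/(numval T x) => sx.
have sw : numval T x <= w := numval_le T x1.
have s0 := numval_ge0 T x; have := pt x x1.
move: (numval T x) sw s0 sx => s sw s0 sx ps.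
have s2w : s ^+ 2 <= w ^+ 2 by rewrite ler_pXn2r ?nnegrE.
have := hL (w ^+ 2) (s ^+ 2); rewrite lexx sqr_ge0 s2w sqr_ge0 => /(_ isT isT).
rewrite [X in L * X]ger0_norm ?subr_ge0// => h.
have {}h := le_trans (ler_norm _) h.
have h2 : L * (w ^+ 2 - s ^+ 2) <= (L * (2 * w)) * (w - s).
  by rewrite -mulrA ler_wpM2l// subr_sqr [leLHS]mulrC ler_wpM2r ?subr_ge0//;
    rewrite mulr_natl mulr2n lerD2l.
have h3 : (L * (2 * w)) * (w - s) <= d.
  have : w - s <= d / (L * (2 * w) + 1) by rewrite lerBlDr -lerBlDl ltW.
  rewrite ler_pdivlMr// mulrC => h3; apply: le_trans h3.
  by rewrite ler_wpM2r ?subr_ge0// lerDl.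
by rewrite -/w; lra.
Qed.

End NumericalRadius.

Theorem theorem2p17 (R : realType) (H : hilbertType R) (T : bounded_op H)
    (phi : R -> R) (phi_orlicz : orlicz phi)
    (alpha : R) (alpha01 : 0 <= alpha <= 1) :
  phi (numrad T ^+ 2) <=
    alpha / 2 * phi (numrad (T ^+ 2)) +
    opnorm ((alpha / 4)%:C *: cfc phi (absop T ^+ 2) +
            (1 - 3 * alpha / 4)%:C *: cfc phi (absop (adjoint T) ^+ 2))
  /\
  phi (numrad T ^+ 2) <=
    alpha / 2 * phi (numrad (T ^+ 2)) +
    opnorm ((alpha / 4)%:C *: cfc phi (absop (adjoint T) ^+ 2) +
            (1 - 3 * alpha / 4)%:C *: cfc phi (absop T ^+ 2)).
Proof.
split; first by apply: orlicz_numrad_le => //; left.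
(* Writing [T] as a double adjoint gives the second inequality the shape of the lemma with
   [S = adjoint T]. *)
rewrite -[in X in opnorm (_ + _ *: cfc phi (absop X ^+ 2))](adjointK T).
by apply: orlicz_numrad_le => //; right.
Qed.
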